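(* Let $(M,\omega)$ be a symplectic manifold and let $U\subset M$ be a (nonempty) open subset with compact closure $\overline{U}\subset M$. Let $\rho$ be a Riemannian metric on $U$ and let $f,g\in C^{\infty}(M)$. Then there exists a constant $C=C(U,\rho,f,g)>0$ such that for every $\varepsilon>0$ and any $F_1,G_1,F_2,G_2\in C^{\infty}(M)$ satisfying $$\|F_1-f\|_U,\ \|F_2-f\|_U,\ \|G_1-g\|_U,\ \|G_2-g\|_U<\varepsilon,$$ we have $$\inf_{y,z\in U}\big|\{F_1,G_1\}(y)-\{F_2,G_2\}(z)\big|\;\leqslant\;C\,\varepsilon\,\max\big(1,\|G_1\|_{U,1},\|G_2\|_{U,1}\big).$$
   Context: For $H\in C^\infty(M)$ the Hamiltonian vector field $X_H$ is defined by $\omega(X_H,\cdot)=dH$ (the sign convention is immaterial), and $\{f,g\}=df(X_g)$. For a function $h$, $\|h\|_U:=\sup_{x\in U}|h(x)|$. With respect to the Riemannian metric $\rho$, for $x\in U$ and $v\in T_xM$ with $\|v\|_\rho=1$, put $\|h\|_{x,v,1}:=\big|\frac{d}{dt}\big|_{t=0}h(\gamma(t))\big|=|dh_x(v)|$, where $\gamma$ is a short $\rho$-geodesic with $\gamma(0)=x$, $\dot\gamma(0)=v$; put $\|h\|_{x,1}:=\max_{\|v\|_\rho=1}\|h\|_{x,v,1}$ and $\|h\|_{U,1}:=\sup_{x\in U}\|h\|_{x,1}$ (possibly $+\infty$). *)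

(* Defs.v *)
From HB Require Import structures.
From mathcomp Require Import all_boot all_order all_algebra.
From mathcomp Require Import all_classical all_reals all_analysis.
Set Implicit Arguments.
Unset Strict Implicit.
Unset Printing Implicit Defensive.
Import Order.TTheory GRing.Theory Num.Theory.
Import numFieldNormedType.Exports.
Local Open Scope classical_set_scope.
Local Open Scope ring_scope.

Section euclidean_smoothness.
Context {R : realType} {m : nat}.

Definition basis_vec (i : 'I_m) : 'rV[R]_m := delta_mx 0 i.

Definition partial (i : 'I_m) (f : 'rV[R]_m -> R) : 'rV[R]_m -> R :=
  'D_(basis_vec i) f.

(* C^oo on A, for A open: every iterated partial derivative is (Frechet)
   differentiable, hence continuous, at every point of A. Only the values of f
   on A matter, since A is open. *)
Definition smooth_on (A : set 'rV[R]_m) (f : 'rV[R]_m -> R) :=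
  forall s : seq 'I_m, forall y, A y -> differentiable (foldr partial f s) y.

End euclidean_smoothness.

(* A homeomorphism between an open subset of T and an open subset of R^m; the
   two total functions are only meaningful on these subsets. *)
Record chart (R : realType) (m : nat) (T : topologicalType) := Chart {
  chart_dom : set T;
  chart_cod : set 'rV[R]_m;
  chart_map : T -> 'rV[R]_m;
  chart_inv : 'rV[R]_m -> T;
  chart_dom_open : open chart_dom;
  chart_cod_open : open chart_cod;
  chart_map_fun : set_fun chart_dom chart_cod chart_map;
  chart_inv_fun : set_fun chart_cod chart_dom chart_inv;
  chart_mapK : {in chart_dom, cancel chart_map chart_inv};
  chart_invK : {in chart_cod, cancel chart_inv chart_map};
  chart_map_continuous : {within chart_dom, continuous chart_map};
  chart_inv_continuous : {within chart_cod, continuous chart_inv} }.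

(* A smooth manifold of dimension m without boundary: Hausdorff, second
   countable, with a smooth atlas. The atlas comes with a choice [chart_at x]
   of one of its charts around each point, used to give coordinates to
   tangent vectors; it carries no further information. *)
Record smooth_manifold (R : realType) (m : nat) := SmoothManifold {
  mfd_space :> topologicalType;
  mfd_hausdorff : hausdorff_space mfd_space;
  mfd_second_countable : @second_countable mfd_space;
  atlas : set (chart R m mfd_space);
  chart_at : mfd_space -> chart R m mfd_space;
  chart_at_atlas : forall x, atlas (chart_at x);
  mem_chart_at : forall x, chart_dom (chart_at x) x;
  atlas_compatible : forall c c', atlas c -> atlas c' -> forall k : 'I_m,
    smooth_on (chart_cod c `&` chart_inv c @^-1` chart_dom c')
              (fun y => chart_map c' (chart_inv c y) 0 k) }.

Section manifold.
Context {R : realType} {m : nat} {M : smooth_manifold R m}.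

Definition smooth (h : M -> R) :=
  forall c, atlas c -> smooth_on (chart_cod c) (h \o chart_inv c).

(* T_xM, identified with R^m by the chart [chart_at x]: v stands for
   \sum_k v_k d/dx_k, where the x_k are the coordinates of [chart_at x]. *)
Definition tangent (x : M) : normedModType R := 'rV[R]_m.

(* dh_x(v). *)
Definition mdiff (h : M -> R) (x : M) (v : tangent x) : R :=
  'd (h \o chart_inv (chart_at x)) (chart_map (chart_at x) x) v.

(* The i-th coordinate vector field of the chart c at x, as an element of
   T_xM, that is, expressed in the coordinates of [chart_at x]. *)
Definition coord_vec (c : chart R m M) (i : 'I_m) (x : M) : tangent x :=
  'd (chart_map (chart_at x) \o chart_inv c) (chart_map c x) (basis_vec i).

(* The components b(d/dx_i, d/dx_j) of the (0,2)-tensor field b in the chart c,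
   as functions on the image of c. *)
Definition tensor_coef (b : forall x : M, tangent x -> tangent x -> R)
    (c : chart R m M) (i j : 'I_m) (y : 'rV[R]_m) : R :=
  let x := chart_inv c y in b x (coord_vec c i x) (coord_vec c j x).

(* (d omega)_ijk = d_i omega_jk + d_j omega_ki + d_k omega_ij. *)
Record symplectic_form := SymplecticForm {
  sform :> forall x : M, {skew_symmetric (tangent x)};
  sform_nondegenerate : forall (x : M) (v : tangent x),
    (forall w : tangent x, sform x v w = 0) -> v = 0;
  sform_smooth : forall c, atlas c -> forall i j,
    smooth_on (chart_cod c) (tensor_coef (fun x => sform x) c i j);
  sform_closed : forall c, atlas c -> forall (i j k : 'I_m) y, chart_cod c y ->
    partial i (tensor_coef (fun x => sform x) c j k) y +
    partial j (tensor_coef (fun x => sform x) c k i) y +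
    partial k (tensor_coef (fun x => sform x) c i j) y = 0 }.

(* A Riemannian metric on the open submanifold U; the inner products at the
   points outside U are irrelevant. *)
Record riemannian_metric (U : set M) := RiemannianMetric {
  metric :> forall x : M, {dot (tangent x) for idfun};
  metric_smooth : forall c, atlas c -> forall i j,
    smooth_on (chart_cod c `&` chart_inv c @^-1` U)
              (tensor_coef (fun x => metric x) c i j) }.

(* X_H(x) is the (unique) vector with omega_x(X_H(x), w) = dH_x(w) for all w. *)
Definition hamiltonian_field (omega : symplectic_form) (H : M -> R) (x : M)
    : tangent x :=
  xget 0 [set v : tangent x | forall w : tangent x, omega x v w = mdiff H w].

Definition poisson (omega : symplectic_form) (f g : M -> R) (x : M) : R :=
  mdiff f (hamiltonian_field omega g x).

Definition sup_norm (U : set M) (h : M -> R) : \bar R :=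
  ereal_sup [set `|h x|%:E | x in U].

(* ||h||_{x,1}. In positive dimension the supremum is a maximum; in dimension 0
   there are no unit vectors and its value is -oo. *)
Definition norm1_at (U : set M) (rho : riemannian_metric U) (h : M -> R)
    (x : M) : \bar R :=
  ereal_sup [set `|mdiff h v|%:E
            | v in [set v : tangent x | Num.sqrt (rho x v v) = 1]].

(* ||h||_{U,1}, possibly +oo. *)
Definition sup_norm1 (U : set M) (rho : riemannian_metric U) (h : M -> R)
    : \bar R :=
  ereal_sup [set norm1_at rho h x | x in U].

End manifold.

Arguments symplectic_form {R m} M.

(* Main.v *)
Require Import Defs.
From HB Require Import structures.
From mathcomp Require Import all_boot all_order all_algebra.
From mathcomp Require Import all_classical all_reals all_analysis.
From mathcomp Require Import perm ring lra.
Import Order.TTheory GRing.Theory Num.Theory.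
Import numFieldNormedType.Exports.
Local Open Scope classical_set_scope.
Local Open Scope ring_scope.

(** Everything happens on one small cube Q inside one chart contained in U, and
    the proof is an integration by parts against a cutoff function.

    Let K be the infimum. Taking y = z, the continuous function
    {F1,G1} - {F2,G2} has absolute value at least K on Q, hence, Q being
    connected, a constant sign, say positive ([cube_constant_sign]). In the
    coordinates of the chart {F,G} is the sum of P_ij d_iF d_jG, where P is the
    transposed inverse of the matrix W of omega, a skew matrix. Multiply by (det W)^2, so
    that S = (det W)^2 P is polynomial in the entries of W, and by the square of
    a bump function psi vanishing on the boundary of Q, and set
    B = psi^2 S and V_j = sum_i d_i B_ij. Skewness of B and the symmetry of
    second derivatives give
      sum_ij B_ij d_iF d_jG = div (F sum_j B_.j d_jG) - F sum_j V_j d_jG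
    ([div_flux]), so that, up to a divergence, psi^2 (det W)^2 times the
    difference of the brackets is
      - F1 V.dG1 + F2 V.dG2
        = - (F1 - f) V.dG1 + (F2 - f) V.dG2 - f V.d(G1 - G2).
    One more integration by parts turns the last term into
    (G1 - G2) div (f V), which involves derivatives of f only
    ([div_comparison_flux]). All vector fields under the divergences vanish on
    the boundary of Q, so integration leaves K on one side and
    eps max (1, |dG1|, |dG2|), times constants depending on psi, W and f, on the
    other ([bracket_estimate]).

    Integration is replaced by Riemann sums over lattices in Q: for h vanishing
    on the two faces of Q orthogonal to the i-th axis, the differences of h over
    one lattice step in direction i add up to zero exactly, and the mean value
    theorem compares them with the values of d_i h ([Riemann_sum_partial],
    [divergence_bound]).

    Finally |d_j G| is at most the norm of the j-th coordinate vector field,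
    bounded on the compact cube, times ||G||_1 ([partial_le_norm1]). *)

(** * Smooth functions of several variables *)

Section SmoothCalculus.
Context {R : realType} {m : nat}.
Implicit Types (A : set 'rV[R]_m) (f g : 'rV[R]_m -> R) (i j : 'I_m).

Lemma smooth_onP A f :
  (forall y, A y -> differentiable f y) ->
  (forall i, smooth_on A (partial i f)) -> smooth_on A f.
Proof.
move=> df pf s; case/lastP: s => [//|s i] y Ay.
by rewrite foldr_rcons; exact: (pf i s y Ay).
Qed.

Lemma smooth_on_differentiable {A f} y : smooth_on A f -> A y ->
  differentiable f y.
Proof. by move=> sf; exact: (sf [::]). Qed.

Lemma smooth_on_continuous {A f} y : smooth_on A f -> A y ->
  {for y, continuous f}.
Proof.
move=> sf Ay; apply/differentiable_continuous.
exact: (smooth_on_differentiable _ sf).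
Qed.

Lemma smooth_on_partial A f i : smooth_on A f -> smooth_on A (partial i f).
Proof.
by move=> sf s y Ay; have := sf (rcons s i) y Ay; rewrite foldr_rcons.
Qed.

Lemma smooth_onS A B f : A `<=` B -> smooth_on B f -> smooth_on A f.
Proof. by move=> AB sf s y /AB; exact: sf. Qed.

(** The differential is selected by a choice operator among the linear maps
    satisfying the first-order expansion, so its locality has to go through the
    uniqueness of that map. *)
Lemma near_zero_is_diff (V W : normedModType R) (e : V -> W) (x : V) :
  (\near x, e x = 0) -> is_diff x e (\0).
Proof.
move=> e0.
have ex : e \o shift x = cst (e x) + (\0 : V -> W) +o_ (0 : V) id.
  apply/eqaddoP => _/posnumP[eps].
  have : \forall y \near (0 : V), e (y + x) = 0.
    by have := e0; rewrite (near_shift 0 x) subr0.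
  apply: filterS => y ey.
  rewrite [X in `|X|](_ : _ = 0) ?normr0 ?mulr_ge0//.
  by rewrite /= !fctE /= ey (nbhs_singleton e0) addr0 subrr.
have de : 'd e x = (\0 : {linear V -> W}) :> (V -> W).
  by apply: diff_unique => //; exact: cst_continuous.
apply: DiffDef => //; apply/diff_locallyP; rewrite de; split => //.
exact: cst_continuous.
Qed.

Lemma near_eq_is_diff (V W : normedModType R) (f g : V -> W) (x : V) :
  (\near x, f x = g x) -> differentiable f x -> is_diff x g ('d f x).
Proof.
move=> fg df.
have gf0 : \near x, (g - f) x = 0.
  by apply: filterS fg => y fgy; rewrite !fctE fgy subrr.
have gf := near_zero_is_diff _ _ _ _ gf0.
have -> : g = (g - f) + f by rewrite subrK.
have dfx : is_diff x f ('d f x) by exact: differentiableP.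
apply: is_diff_eq; exact: add0r.
Qed.

Lemma eq_foldr_partial A f g (s : seq 'I_m) :
  open A -> (forall y, A y -> f y = g y) ->
  forall y, A y -> foldr partial f s y = foldr partial g s y.
Proof.
move=> oA fg; elim: s => [//|i s IHs] y Ay /=.
apply: near_eq_derive; near=> z; apply: IHs.
by near: z; exact: open_nbhs_nbhs.
Unshelve. all: by end_near. Qed.

Lemma eq_smooth_on A f g : open A -> (forall y, A y -> f y = g y) ->
  smooth_on A f -> smooth_on A g.
Proof.
move=> oA fg sf s y Ay.
suff : is_diff y (foldr partial g s) ('d (foldr partial f s) y) by [].
apply: near_eq_is_diff; last exact: sf.
near=> z; apply: (eq_foldr_partial _ _ _ s oA fg).
by near: z; exact: open_nbhs_nbhs.
Unshelve. all: by end_near. Qed.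

Lemma partialD i f g y : differentiable f y -> differentiable g y ->
  partial i (f + g) y = partial i f y + partial i g y.
Proof. by move=> df dg; apply: deriveD; exact: diff_derivable. Qed.

Lemma partialM i f g y : differentiable f y -> differentiable g y ->
  partial i (f * g) y = f y * partial i g y + g y * partial i f y.
Proof. by move=> df dg; apply: deriveM; exact: diff_derivable. Qed.

Lemma partialB i f g y : differentiable f y -> differentiable g y ->
  partial i (f - g) y = partial i f y - partial i g y.
Proof. by move=> df dg; apply: deriveB; exact: diff_derivable. Qed.

Lemma partial_sum i n (F : 'I_n -> 'rV[R]_m -> R) y :
  (forall k, differentiable (F k) y) ->
  partial i (\sum_k F k) y = \sum_k partial i (F k) y.
Proof. by move=> dF; apply: derive_sum => k; exact: diff_derivable. Qed.

(** Coinduction: smoothness on A follows from membership in any class of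
    differentiable functions that is stable, up to equality on A, under partial
    derivatives. This avoids expanding iterated derivatives of a product. *)
Lemma smooth_on_coind A (C : ('rV[R]_m -> R) -> Prop) : open A ->
  (forall h, C h -> forall y, A y -> differentiable h y) ->
  (forall h i, C h ->
    exists2 h', C h' & forall y, A y -> h' y = partial i h y) ->
  forall h, C h -> smooth_on A h.
Proof.
move=> oA dC pC h Ch s; elim/last_ind: s h Ch => [|s i IHs] h Ch.
  exact: dC.
have [h' Ch' h'E] := pC h i Ch; rewrite foldr_rcons => y Ay.
suff : is_diff y (foldr partial (partial i h) s) ('d (foldr partial h' s) y).
  by [].
apply: near_eq_is_diff; last exact: IHs.
near=> z; apply: (eq_foldr_partial A _ _ s oA h'E).
by near: z; exact: open_nbhs_nbhs.
Unshelve. all: by end_near. Qed.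

(** The class to which coinduction is applied to get sums and products at once:
    by the Leibniz rule it is stable under partial derivatives. *)
Inductive smooth_ring A : ('rV[R]_m -> R) -> Prop :=
| SmoothGen f of smooth_on A f : smooth_ring A f
| SmoothAdd f g of smooth_ring A f & smooth_ring A g : smooth_ring A (f + g)
| SmoothMul f g of smooth_ring A f & smooth_ring A g : smooth_ring A (f * g).

Lemma smooth_ring_smooth_on A h : open A -> smooth_ring A h -> smooth_on A h.
Proof.
move=> oA; have dring f : smooth_ring A f -> forall y, A y -> differentiable f y.
  elim=> [{}f sf y|{}f g _ IHf _ IHg y Ay|{}f g _ IHf _ IHg y Ay].
  - exact: smooth_on_differentiable.
  - by apply: differentiableD; [exact: IHf|exact: IHg].
  - by apply: differentiableM; [exact: IHf|exact: IHg].
apply: smooth_on_coind => // f i.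
elim=> [{}f sf|{}f g rf [f' rf' f'E] rg [g' rg' g'E]
       |{}f g rf [f' rf' f'E] rg [g' rg' g'E]].
- by exists (partial i f) => //; apply/SmoothGen/smooth_on_partial.
- exists (f' + g'); first exact: SmoothAdd.
  move=> y Ay; rewrite (partialD _ _ _ _ (dring _ rf y Ay) (dring _ rg y Ay)).
  by rewrite -f'E// -g'E.
- exists (f * g' + g * f'); first by apply: SmoothAdd; exact: SmoothMul.
  move=> y Ay; rewrite (partialM _ _ _ _ (dring _ rf y Ay) (dring _ rg y Ay)).
  by rewrite -f'E// -g'E.
Qed.

Lemma smooth_onD A f g : open A -> smooth_on A f -> smooth_on A g ->
  smooth_on A (f + g).
Proof.
by move=> oA *; apply/smooth_ring_smooth_on/SmoothAdd => //; exact: SmoothGen.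
Qed.

Lemma smooth_onM A f g : open A -> smooth_on A f -> smooth_on A g ->
  smooth_on A (f * g).
Proof.
by move=> oA *; apply/smooth_ring_smooth_on/SmoothMul => //; exact: SmoothGen.
Qed.

Lemma smooth_on_cst A (a : R) : open A -> smooth_on A (cst a).
Proof.
move=> oA; apply: (smooth_on_coind A (fun h => exists b, h = cst b)) => //.
- by move=> _ [b ->] y _; exact: differentiable_cst.
- move=> _ i [b ->]; exists (cst 0); first by exists 0.
  by move=> y _; rewrite /partial derive_cst.
- by exists a.
Qed.

Lemma partial_coord (i j : 'I_m) y :
  partial i (fun y => y 0 j) y = (i == j)%:R :> R.
Proof.
have /matrixP/(_ 0 j) := derive_mx (@derivable_id _ _ y (basis_vec i)).
by rewrite derive_id /basis_vec !mxE eqxx/= eq_sym => ->.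
Qed.

Lemma smooth_on_coord A (j : 'I_m) : open A ->
  smooth_on A (fun y => y 0 j).
Proof.
move=> oA; apply: smooth_onP => [y _|i]; first exact: differentiable_coord.
apply: (eq_smooth_on A (cst (i == j)%:R)) => //; last exact: smooth_on_cst.
by move=> y _; rewrite partial_coord.
Qed.

Lemma smooth_onN A f : open A -> smooth_on A f -> smooth_on A (- f).
Proof.
move=> oA sf; have -> : - f = cst (-1) * f.
  by apply/funext => y; rewrite /GRing.mul/= mulN1r.
by apply: smooth_onM => //; exact: smooth_on_cst.
Qed.

Lemma smooth_onB A f g : open A -> smooth_on A f -> smooth_on A g ->
  smooth_on A (f - g).
Proof. by move=> oA sf sg; apply: smooth_onD => //; exact: smooth_onN. Qed.

Lemma smooth_on_sum A (I : Type) (r : seq I) (P : pred I)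
    (F : I -> 'rV[R]_m -> R) : open A ->
  (forall k, P k -> smooth_on A (F k)) -> smooth_on A (\sum_(k <- r | P k) F k).
Proof.
move=> oA sF; apply: big_ind => //; first exact: (smooth_on_cst A 0).
by move=> *; exact: smooth_onD.
Qed.

Lemma smooth_on_prod A (I : Type) (r : seq I) (P : pred I)
    (F : I -> 'rV[R]_m -> R) : open A ->
  (forall k, P k -> smooth_on A (F k)) ->
  smooth_on A (\prod_(k <- r | P k) F k).
Proof.
move=> oA sF; apply: big_ind => //; first exact: (smooth_on_cst A 1).
by move=> *; exact: smooth_onM.
Qed.

Lemma is_derive_line f (y v : 'rV[R]_m) (t : R) :
  differentiable f (y + t *: v) ->
  is_derive t 1 (fun u => f (y + u *: v)) ('D_v f (y + t *: v)).
Proof.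
move=> df; pose l u : 'rV[R]_m := y + u *: v.
have dl : is_diff t l ( *:%R ^~ v).
  have -> : l = cst y + ( *:%R ^~ v) by apply/funext.
  have dc : is_diff t (cst y) (0 : R -> 'rV[R]_m) by exact: is_diff_cst.
  have ds : is_diff t ( *:%R ^~ v) ( *:%R ^~ v) by exact: is_diff_scalel.
  have := is_diffD dc ds; rewrite add0r; exact.
have dlt : differentiable l t by exact: (@ex_diff _ _ _ _ _ _ _ dl).
have dfl : differentiable (f \o l) t by exact: differentiable_comp.
apply: DeriveDef; first exact: diff_derivable.
by rewrite deriveE// diff_comp//= (@diff_val _ _ _ _ _ _ _ dl)/= scale1r deriveE.
Qed.

Lemma partial_MVT f (y : 'rV[R]_m) (i : 'I_m) (a : R) : 0 <= a ->
  (forall t : R, 0 <= t <= a -> differentiable f (y + t *: basis_vec i)) ->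
  exists2 t : R, 0 <= t <= a &
    f (y + a *: basis_vec i) - f y = partial i f (y + t *: basis_vec i) * a.
Proof.
move=> a0 df; pose h t := f (y + t *: basis_vec i).
have dh t : t \in `[0, a] ->
    is_derive t 1 h (partial i f (y + t *: basis_vec i)).
  by rewrite in_itv/= => ta; exact/is_derive_line/df.
have [|t ta e] := @MVT_segment R h _ 0 a a0
    (fun t ta => dh t (subset_itv_oo_cc ta)).
  apply: derivable_within_continuous => t ta.
  by have [] := dh t ta.
exists t; first by move: ta; rewrite in_itv.
by move: e; rewrite /h scale0r addr0 subr0.
Qed.

(** Two applications of the mean value theorem, first along e_i to the increment
    of f in direction e_j, then along e_j. The left-hand side is symmetric in i
    and j, which is what gives the symmetry of second derivatives. *)
Lemma second_difference f (A : set 'rV[R]_m) i j (y : 'rV[R]_m) (a : R) :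
  smooth_on A f -> 0 <= a ->
  (forall s t : R, 0 <= s <= a -> 0 <= t <= a ->
    A (y + s *: basis_vec i + t *: basis_vec j)) ->
  exists s t : R, [/\ 0 <= s <= a, 0 <= t <= a &
    f (y + a *: basis_vec i + a *: basis_vec j) - f (y + a *: basis_vec i)
    - f (y + a *: basis_vec j) + f y =
    partial j (partial i f) (y + s *: basis_vec i + t *: basis_vec j) * a ^+ 2].
Proof.
move=> sf a0 yA; pose h s := f (y + a *: basis_vec j + s *: basis_vec i) -
  f (y + s *: basis_vec i).
have dh s : s \in `[0, a] -> is_derive s 1 h
    (partial i f (y + a *: basis_vec j + s *: basis_vec i)
     - partial i f (y + s *: basis_vec i)).
  rewrite in_itv/= => sa; apply: is_deriveB; apply/is_derive_line/(sf [::]).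
    by rewrite addrAC; apply: yA => //; rewrite lexx a0.
  by have := yA s 0 sa; rewrite scale0r addr0 lexx a0; apply.
have [|s sa e] := @MVT_segment R h _ 0 a a0
    (fun t ta => dh t (subset_itv_oo_cc ta)).
  by apply: derivable_within_continuous => s sa; have [] := dh s sa.
have {}sa : 0 <= s <= a by move: sa; rewrite in_itv.
have [t ta e'] := @partial_MVT (partial i f) (y + s *: basis_vec i) j a a0
  (fun t ta => smooth_on_partial _ _ i sf [::] _ (yA s t sa ta)).
exists s, t; split => //.
move: e; rewrite (addrAC y _ (s *: _)) e' subr0 /h scale0r !addr0.
rewrite opprB addrA => e.
by rewrite expr2 mulrA -e (addrAC y) [LHS]addrAC.
Qed.

(** Both sides are limits of the same second difference quotient over squares
    shrinking to y. *)
Lemma partialC f (A : set 'rV[R]_m) i j (y : 'rV[R]_m) : open A ->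
  smooth_on A f -> A y ->
  partial i (partial j f) y = partial j (partial i f) y.
Proof.
move=> oA sf Ay; apply/eqP; rewrite -subr_eq0 -normr_le0.
apply/ler_addgt0Pl => e e0; rewrite addr0.
have close (u v w : R) : `|u - w| < e / 2 -> `|v - w| < e / 2 -> `|u - v| <= e.
  move=> uw vw; rewrite [leRHS](splitr e).
  by rewrite (le_trans (ler_distD w _ _)) ?lerD ?ltW// distrC.
have cont k l : \forall z \near y,
    `|partial k (partial l f) y - partial k (partial l f) z| < e / 2.
  have /cvgrPdist_lt := smooth_on_continuous y
    (smooth_on_partial _ _ k (smooth_on_partial _ _ l sf)) Ay.
  by apply; rewrite divr_gt0.
have [d /= d0 yd] : nbhs_ball y (A `&`
    ([set z | `|partial i (partial j f) y - partial i (partial j f) z| < e / 2]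
     `&` [set z | `|partial j (partial i f) y - partial j (partial i f) z|
                  < e / 2])).
  apply/nbhs_ballP/filterI; first exact: open_nbhs_nbhs.
  by apply: filterI; exact: cont.
(* A square of side d / b stays in the ball of radius d around y. *)
pose b : R := `|basis_vec i : 'rV[R]_m| + `|basis_vec j : 'rV[R]_m| + 1.
have b0 : 0 < b by rewrite ltr_wpDl ?addr_ge0.
pose a := d / b.
have a0 : 0 < a by rewrite divr_gt0.
have near_y (s t : R) : 0 <= s <= a -> 0 <= t <= a ->
    ball y d (y + s *: basis_vec i + t *: basis_vec j).
  move=> /andP[s0 sa] /andP[t0 ta]; rewrite -ball_normE/=.
  rewrite -addrA opprD addNKr normrN (le_lt_trans (ler_normD _ _))//.
  rewrite !normrZ !ger0_norm//.
  apply: (@le_lt_trans _ _ (a * (b - 1))).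
    by rewrite /b addrK mulrDr lerD// ler_wpM2r.
  by rewrite mulrBr mulr1 divfK ?gt_eqF// gtrBl.
have [|s [t [sa ta e1]]] := @second_difference f A i j y a sf (ltW a0).
  by move=> s t sa ta; have [] := yd _ (near_y s t sa ta).
have [|s' [t' [sa' ta' e2]]] := @second_difference f A j i y a sf (ltW a0).
  by move=> s' t' sa' ta'; rewrite addrAC; have [] := yd _ (near_y _ _ ta' sa').
have {e1 e2} e12 :
  partial j (partial i f) (y + s *: basis_vec i + t *: basis_vec j)
  = partial i (partial j f) (y + s' *: basis_vec j + t' *: basis_vec i).
  apply: (@mulIf _ (a ^+ 2)); first by rewrite expf_neq0 ?gt_eqF.
  apply: etrans (esym e1) (etrans _ e2).
  by rewrite (addrAC y (a *: basis_vec j)); congr (_ + _); exact: addrAC.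
have [_ [_ ji]] := yd _ (near_y s t sa ta).
have [_ [+ _]] := yd _ (near_y t' s' ta' sa').
rewrite /= (addrAC y (t' *: _)) -e12 => ij.
exact: close ij ji.
Qed.

End SmoothCalculus.

(** * A discrete divergence theorem on a cube *)

Section Divergence.
Context {R : realType} {m : nat}.
Variables (a : 'rV[R]_m) (r : R).
Hypothesis r0 : 0 < r.

Definition cube : set 'rV[R]_m :=
  [set y | forall i, a 0 i <= y 0 i <= a 0 i + r].

(** Here both opposite faces orthogonal to the i-th axis are meant, extended to
    full hyperplanes. *)
Definition face (i : 'I_m) : set 'rV[R]_m :=
  [set y | y 0 i = a 0 i \/ y 0 i = a 0 i + r].

Definition cube_bump (y : 'rV[R]_m) : R :=
  \prod_(i < m) ((y 0 i - a 0 i) * (a 0 i + r - y 0 i)).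

Lemma cube_compact : compact cube.
Proof.
have := @rV_compact R m (fun i => `[a 0 i, a 0 i + r]%classic)
  (fun i => @segment_compact R _ _).
by congr compact; apply/seteqP; split => y ya i; have := ya i; rewrite /= in_itv.
Qed.

Lemma bump_face i y : face i y -> cube_bump y = 0.
Proof.
by move=> [|] yi; rewrite /cube_bump (bigD1 i)//= yi subrr ?mul0r ?mulr0 ?mul0r.
Qed.

Lemma continuous_bounded_on_cube (A : set 'rV[R]_m)
    (h : 'rV[R]_m -> R) : cube `<=` A ->
  (forall y, A y -> {for y, continuous h}) ->
  exists2 b : R, 0 <= b & forall y, cube y -> `|h y| <= b.
Proof.
move=> QA hc.
have ca : cube a by move=> i; rewrite lexx lerDl ltW.
have wc : {within cube, continuous (fun y => `|h y|)}.
  apply: continuous_in_subspaceT => y /set_mem /QA Ay.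
  apply: (@continuous_comp _ _ _ h) (hc y Ay) _; exact: norm_continuous.
have [c _ hle] := EVT_max_rV (ex_intro _ a ca) cube_compact wc.
by exists `|h c| => // y Qy; apply: hle; rewrite inE.
Qed.

Section Lattice.
Variable n : nat.
Local Notation N := n.+1.
Local Notation eta := (r / N%:R).
Local Notation index := {ffun 'I_m -> 'I_N}.

Definition lattice_pt (k : index) : 'rV[R]_m := \row_j (a 0 j + (k j)%:R * eta).

Definition cyclic_shift (i : 'I_m) (k : index) : index :=
  [ffun j => if j == i then ordS (k j) else k j].

Lemma cyclic_shift_inj i : injective (cyclic_shift i).
Proof.
move=> k l /ffunP kl; apply/ffunP => j; have := kl j; rewrite !ffunE.
by case: eqP => // _; exact: (bij_inj (@ordS_bij N)).
Qed.

Lemma eta_gt0 : 0 < eta. Proof. by rewrite divr_gt0. Qed.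

Lemma mul_eta_succ (p : nat) : p%:R * eta + eta = p.+1%:R * eta.
Proof. by rewrite -[p.+1%:R]natr1 mulrDl mul1r. Qed.

Lemma lattice_pt_line_cube k i (t : R) : 0 <= t <= eta ->
  cube (lattice_pt k + t *: basis_vec i).
Proof.
move=> /andP[t0 te] j; rewrite !mxE eqxx/=.
have kN : (k j)%:R * eta + eta <= r.
  rewrite mul_eta_succ mulrA ler_pdivrMr// mulrC ler_pM2l// ler_nat; exact: ltn_ord.
have k0 : 0 <= (k j)%:R * eta by rewrite mulr_ge0// ltW// eta_gt0.
have e0 := eta_gt0.
move: eta (_ * eta) t0 te kN k0 e0 => h x *.
by case: (j == i); rewrite /= ?mulr1 ?mulr0; apply/andP; split; lra.
Qed.

Lemma lattice_pt_cube k : cube (lattice_pt k).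
Proof.
move=> j; have := lattice_pt_line_cube k j 0.
by rewrite lexx ltW ?eta_gt0// scale0r addr0 => /(_ isT j).
Qed.

(** A lattice step in direction i is the cyclic shift of the i-th index, as a
    step leading out of the last layer joins the two faces, on both of which h
    vanishes. *)
Lemma shift_lattice_pt (h : 'rV[R]_m -> R) i k :
  (forall y, cube y -> face i y -> h y = 0) ->
  h (lattice_pt k + eta *: basis_vec i) = h (lattice_pt (cyclic_shift i k)).
Proof.
move=> h0; have [kN|Nk] := ltnP (k i).+1 N.
  congr h; apply/rowP => j; rewrite !mxE !ffunE eqxx/=.
  have [->|ji] := eqVneq j i; last by rewrite mulr0 addr0.
  by rewrite /= modn_small// -addrA mulr1 mul_eta_succ.
have kE : (k i).+1 = N by apply/eqP; rewrite eqn_leq Nk ltn_ord.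
have e0 := eta_gt0.
rewrite !h0//; [exact: lattice_pt_cube| | |].
- by left; rewrite !mxE !ffunE eqxx/= kE modnn mul0r addr0.
- by apply: lattice_pt_line_cube; rewrite lexx ltW.
- right; rewrite !mxE eqxx/= eqxx mulr1 -addrA mul_eta_succ kE.
  by rewrite mulrC divfK// pnatr_eq0.
Qed.

(** The cyclic shift permutes the lattice, so this is an exact discrete form of
    the vanishing of the integral of a partial derivative. *)
Lemma sum_shift_lattice (h : 'rV[R]_m -> R) i :
  (forall y, cube y -> face i y -> h y = 0) ->
  \sum_k (h (lattice_pt k + eta *: basis_vec i) - h (lattice_pt k)) = 0.
Proof.
move=> h0; rewrite sumrB [X in _ - X](reindex_inj (@cyclic_shift_inj i))/=.
by apply/eqP; rewrite subr_eq0; apply/eqP/eq_bigr => k _; exact: shift_lattice_pt.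
Qed.

(** By the mean value theorem a difference quotient of h is a value of the
    derivative of h at distance at most eta, hence differs from the value at the
    lattice point by at most b * eta. *)
Lemma Riemann_sum_partial (A : set 'rV[R]_m) (h : 'rV[R]_m -> R) i (b : R) :
  cube `<=` A -> smooth_on A h -> (forall y, cube y -> face i y -> h y = 0) ->
  (forall y, cube y -> `|partial i (partial i h) y| <= b) ->
  `|\sum_k partial i h (lattice_pt k)| <= #|index|%:R * (b * eta).
Proof.
move=> QA sh h0 hb.
have e0 := eta_gt0.
have /(congr1 (fun s => s / eta)) := sum_shift_lattice h i h0.
rewrite mul0r mulr_suml => s0.
rewrite -[X in `|X|]subr0 -[X in _ - X]s0 -sumrB.
rewrite (le_trans (ler_norm_sum _ _ _))//.
rewrite mulr_natl -sumr_const ler_sum// => k _.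
have Ak t : 0 <= t <= eta -> A (lattice_pt k + t *: basis_vec i).
  by move=> te; exact/QA/lattice_pt_line_cube.
have [t te ->] := partial_MVT h (lattice_pt k) i eta (ltW e0)
  (fun t te => sh [::] _ (Ak t te)).
rewrite mulfK ?gt_eqF// distrC.
have /andP[t0 tle] := te.
have Ak' u : 0 <= u <= t -> A (lattice_pt k + u *: basis_vec i).
  by move=> /andP[u0 ut]; apply: Ak; rewrite u0 (le_trans ut).
have [u /andP[u0 ut] ->] := partial_MVT (partial i h) (lattice_pt k) i t t0
  (fun u ut => smooth_on_partial _ _ i sh [::] _ (Ak' u ut)).
rewrite normrM (ger0_norm t0) ler_pM// hb//.
by apply: lattice_pt_line_cube; rewrite u0 (le_trans ut).
Qed.

Lemma sum_quartic (x : R) (p : nat) :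
  \sum_(l < p) (l%:R * (x - l%:R)) ^+ 2 =
  x ^+ 2 * ((p%:R - 1) * p%:R * (2 * p%:R - 1) / 6)
  - 2 * x * ((p%:R - 1) * p%:R / 2) ^+ 2
  + p%:R * (p%:R - 1) * (2 * p%:R - 1) * (3 * p%:R ^+ 2 - 3 * p%:R - 1) / 30.
Proof.
elim: p => [|p IHp]; first by rewrite big_ord0; field.
by rewrite big_ord_recr/= IHp -natr1; field.
Qed.

(** The sum over the lattice factors into m equal one-dimensional sums of
    (t (r - t))^2, whose mean is r^4 (1 - N^-4) / 30 for N points. *)
Lemma sum_bump_lattice : (1 < N)%N ->
  #|index|%:R * ((r ^+ 4 / 32) ^+ m) <= \sum_k cube_bump (lattice_pt k) ^+ 2.
Proof.
move=> N1; pose g (l : 'I_N) : R := (l%:R * eta * (r - l%:R * eta)) ^+ 2.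
have -> : \sum_k cube_bump (lattice_pt k) ^+ 2 = \prod_(j < m) \sum_(l < N) g l.
  rewrite bigA_distr_bigA/=; apply: eq_bigr => k _.
  rewrite /cube_bump -prodrXl; apply: eq_bigr => j _.
  by rewrite mxE /g; congr (_ ^+ 2); ring.
rewrite prodr_const card_ord card_ffun !card_ord natrX -exprMn.
rewrite lerXn2r// ?nnegrE ?mulr_ge0 ?divr_ge0 ?exprn_ge0 ?(ltW r0)//.
  by apply: sumr_ge0 => l _; exact: sqr_ge0.
have N0 : N%:R != 0 :> R by rewrite pnatr_eq0.
have -> : \sum_(l < N) g l =
    r ^+ 4 / N%:R ^+ 4 * \sum_(l < N) (l%:R * (N%:R - l%:R)) ^+ 2.
  by rewrite mulr_sumr; apply: eq_bigr => l _; rewrite /g; field.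
rewrite sum_quartic.
have N2 : 2 <= N%:R :> R by rewrite ler_nat.
set x := N%:R in N0 N2 *.
have -> : r ^+ 4 / x ^+ 4 * (x ^+ 2 * ((x - 1) * x * (2 * x - 1) / 6) -
  2 * x * ((x - 1) * x / 2) ^+ 2 +
  x * (x - 1) * (2 * x - 1) * (3 * x ^+ 2 - 3 * x - 1) / 30) =
  x * r ^+ 4 * ((1 - (x ^+ 4)^-1) / 30) by field.
rewrite mulrA ler_wpM2l ?mulr_ge0 ?exprn_ge0 ?(ltW r0)//.
have : (x ^+ 4)^-1 <= 16^-1.
  rewrite lef_pV2 ?posrE ?exprn_gt0 ?ltr0n//.
  rewrite (_ : 16 = 2 ^+ 4 :> R); last by ring.
  by rewrite lerXn2r// nnegrE; lra.
move: (x ^- 4) => v hv; have -> : 32^-1 = (1 - 16^-1) / 30 :> R by field.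
by rewrite ler_pM2r ?invr_gt0 ?ltr0n// lerD2l lerN2.
Qed.

End Lattice.

(** Sum the hypothesis over a lattice: the divergence contributes only an error
    of the order of the step, and (r^4 / 32)^m bounds from below the mean of the
    square of the bump, uniformly in the step. Letting the step tend to 0 gives
    the claim. *)
Lemma divergence_bound (A : set 'rV[R]_m) (H : 'I_m -> 'rV[R]_m -> R)
    (kap e : R) :
  cube `<=` A -> (forall i, smooth_on A (H i)) ->
  (forall i y, cube y -> face i y -> H i y = 0) -> 0 <= kap ->
  (forall y, cube y -> kap * cube_bump y ^+ 2 <= \sum_i partial i (H i) y + e) ->
  kap * (r ^+ 4 / 32) ^+ m <= e.
Proof.
move=> QA sH H0 kap0 kapH; apply/ler_addgt0Pl => d d0.
have bnd i : exists b : R, forall y, cube y -> `|partial i (partial i (H i)) y| <= b.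
  have [|b _ hb] := @continuous_bounded_on_cube A (partial i (partial i (H i))) QA.
    move=> y Ay; apply: smooth_on_continuous Ay.
    by do 2 apply: smooth_on_partial.
  by exists b.
have [b bE] := choice bnd.
(* The lattice is chosen so fine that the total error is at most d. *)
pose B := `|\sum_i b i|.
pose n := (Num.trunc (B * r / d)).+1.
have index0 : 0 < #|{ffun 'I_m -> 'I_n.+1}|%:R :> R.
  by rewrite ltr0n card_ffun !card_ord expn_gt0.
have Bn : B * (r / n.+1%:R) <= d.
  rewrite mulrA ler_pdivrMr// [leRHS]mulrC -ler_pdivrMr// ltW//.
  by rewrite (lt_trans (truncnS_gt _))// ltr_nat.
rewrite -(ler_pM2l index0) mulrCA.
apply: (le_trans (ler_wpM2l kap0 (sum_bump_lattice n isT))).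
rewrite mulr_sumr.
have Qk (k : {ffun 'I_m -> 'I_n.+1}) : cube (lattice_pt n k).
  exact: lattice_pt_cube.
apply: (le_trans (ler_sum _ (fun k _ => kapH _ (Qk k)))).
rewrite big_split/= sumr_const -[e *+ _]mulr_natl mulrDr.
apply: lerD; last exact: lexx.
rewrite exchange_big/=.
apply: (le_trans (ler_norm _)); apply: (le_trans (ler_norm_sum _ _ _)).
apply: (le_trans (ler_sum _ (fun i _ =>
  Riemann_sum_partial n A (H i) i (b i) QA (sH i) (H0 i) (bE i)))).
rewrite -mulr_sumr ler_pM2l// -mulr_suml (le_trans _ Bn)//.
by rewrite ler_wpM2r ?ler_norm// divr_ge0// ltW.
Qed.

Lemma cube_segment (y z : 'rV[R]_m) (t : R) :
  0 <= t <= 1 -> cube y -> cube z -> cube (y + t *: (z - y)).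
Proof.
move=> /andP[t0 t1] Qy Qz i; rewrite !mxE.
move: (y 0 i) (z 0 i) (a 0 i) (Qy i) (Qz i) => u v w uw vw.
by apply/andP; split; nra.
Qed.

(** By the intermediate value theorem on segments a change of sign would produce
    a zero of h. *)
Lemma cube_constant_sign (h : 'rV[R]_m -> R) (k : R) :
  0 < k -> (forall y, cube y -> {for y, continuous h}) ->
  (forall y, cube y -> k <= `|h y|) ->
  (forall y, cube y -> k <= h y) \/ (forall y, cube y -> k <= - h y).
Proof.
move=> k0 hc hk.
have aQ : cube a by move=> i; rewrite lexx lerDl ltW.
have nonzero y : cube y -> 0 < h a * h y.
  move=> Qy; rewrite ltNge; apply/negP => ay0.
  pose g (t : R) := h (a + t *: (y - a)).
  have gc : {within `[0, 1], continuous g}.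
    apply: continuous_in_subspaceT => t; rewrite inE/= in_itv/= => t01.
    apply: (@continuous_comp _ _ _ (fun t : R => a + t *: (y - a)) h).
      apply: cvgD; first exact: cvg_cst.
      by apply: cvgZr_tmp; exact: cvg_id.
    by apply: hc; exact: cube_segment.
  have g0 : g 0 = h a by rewrite /g scale0r addr0.
  have g1 : g 1 = h y by rewrite /g scale1r addrC subrK.
  have [|t t01 gt0] := @IVT R g 0 1 0 ler01 gc.
    rewrite g0 g1 ge_min le_max.
    by have [] := lerP (h a) 0; have [] := lerP (h y) 0 => /=; nra.
  have := hk _ (cube_segment a y t t01 aQ Qy).
  by rewrite -/(g t) gt0 normr0; lra.
have ha0 : h a != 0.
  by rewrite -normr_gt0 (lt_le_trans k0)// hk.
have [ha|ha] := ltP 0 (h a); [left|right] => y Qy; have := nonzero y Qy.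
  by rewrite pmulr_rgt0// => hy; have := hk y Qy; rewrite gtr0_norm.
have {}ha : h a < 0 by rewrite lt_neqAle ha0.
by rewrite nmulr_rgt0// => hy; have := hk y Qy; rewrite ltr0_norm.
Qed.

End Divergence.

(** * The estimate for a skew bivector on a cube *)

Section BracketEstimate.
Context {R : realType} {m : nat}.
Variables (A : set 'rV[R]_m) (a : 'rV[R]_m) (r : R).
Hypotheses (openA : open A) (r0 : 0 < r) (cubeA : cube a r `<=` A).

Lemma smooth_on_bump : smooth_on A (cube_bump a r).
Proof.
pose x i : 'rV[R]_m -> R := fun y => y 0 i.
have -> : cube_bump a r =
    \prod_(i < m) ((x i - cst (a 0 i)) * (cst (a 0 i + r) - x i)).
  by apply/funext => y; rewrite fct_prodE.
apply: smooth_on_prod => // i _; apply: smooth_onM => //; apply: smooth_onB => //.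
- exact: smooth_on_coord.
- exact: smooth_on_cst.
- exact: smooth_on_cst.
- exact: smooth_on_coord.
Qed.

Section CutoffTensor.
Variable S : 'I_m -> 'I_m -> 'rV[R]_m -> R.
Hypothesis smoothS : forall i j, smooth_on A (S i j).

(** The bump enters squared so that the first derivatives of the tensor vanish
    on the faces too. *)
Definition cutoff_tensor i j : 'rV[R]_m -> R :=
  cube_bump a r * cube_bump a r * S i j.

Definition tensor_div j : 'rV[R]_m -> R := \sum_i partial i (cutoff_tensor i j).

Local Notation B := cutoff_tensor.
Local Notation V := tensor_div.

Lemma smooth_on_cutoff i j : smooth_on A (B i j).
Proof.
apply: smooth_onM => //; apply: smooth_onM => //; exact: smooth_on_bump.
Qed.

Lemma smooth_on_tensor_div j : smooth_on A (V j).
Proof.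
apply: smooth_on_sum => // i _; apply: smooth_on_partial.
exact: smooth_on_cutoff.
Qed.

Lemma cutoff_face k i j y : face a r k y -> B i j y = 0.
Proof. by move=> yk; rewrite /B /= !fctE (bump_face _ _ _ _ yk) !mul0r. Qed.

Lemma tensor_div_face k j y : cube a r y -> face a r k y -> V j y = 0.
Proof.
move=> /cubeA Ay yk; rewrite /V fct_sumE big1// => i _.
have db := smooth_on_differentiable y smooth_on_bump Ay.
have dS := smooth_on_differentiable y (smoothS i j) Ay.
rewrite /B partialM//; last exact: differentiableM.
by rewrite partialM// !fctE (bump_face _ _ _ _ yk) !(mul0r, mulr0, addr0).
Qed.

(** The vector field F sum_j B_ij d_jG, with F in front: integrating by parts
    takes the derivative off F, on which there is no C^1 bound. *)
Definition flux (F G : 'rV[R]_m -> R) i : 'rV[R]_m -> R :=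
  F * \sum_j (B i j * partial j G).

Lemma smooth_on_flux F G i : smooth_on A F -> smooth_on A G ->
  smooth_on A (flux F G i).
Proof.
move=> sF sG; apply: smooth_onM => //; apply: smooth_on_sum => // j _.
by apply: smooth_onM => //; [exact: smooth_on_cutoff|exact: smooth_on_partial].
Qed.

Hypothesis antiS : forall i j y, A y -> S i j y = - S j i y.

(** A skew matrix contracted with a symmetric one. *)
Lemma cutoff_hessian0 G y : smooth_on A G -> A y ->
  \sum_i \sum_j B i j y * partial i (partial j G) y = 0.
Proof.
move=> sG Ay; set s := (LHS).
have : s = - s.
  rewrite {1}/s exchange_big/= -sumrN; apply: eq_bigr => i _.
  rewrite -sumrN; apply: eq_bigr => j _.
  rewrite (partialC _ _ _ _ _ openA sG Ay) -mulNr; congr (_ * _).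
  by rewrite /B !fctE antiS// mulrN.
by move=> ?; lra.
Qed.

(** The Leibniz rule; the second derivatives of G disappear by
    [cutoff_hessian0]. *)
Lemma div_flux F G y : smooth_on A F -> smooth_on A G -> A y ->
  \sum_i partial i (flux F G i) y =
  cube_bump a r y ^+ 2 * (\sum_i \sum_j S i j y * (partial i F y * partial j G y))
  + F y * \sum_j V j y * partial j G y.
Proof.
move=> sF sG Ay.
have dB i j := smooth_on_differentiable y (smooth_on_cutoff i j) Ay.
have dF := smooth_on_differentiable y sF Ay.
have dG j := smooth_on_differentiable y (smooth_on_partial _ _ j sG) Ay.
have dBG i j := differentiableM (dB i j) (dG j).
have -> : \sum_j V j y * partial j G y =
    \sum_i \sum_j partial j G y * partial i (B i j) y.
  rewrite exchange_big/=; apply: eq_bigr => j _.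
  by rewrite /V fct_sumE mulr_suml; apply: eq_bigr => i _; rewrite mulrC.
rewrite -[X in F y * X]add0r.
rewrite -[X in F y * (X + _)](cutoff_hessian0 _ _ sG Ay) -big_split/=.
rewrite !mulr_sumr -big_split/=; apply: eq_bigr => i _.
rewrite /flux partialM//; last exact: differentiable_sum.
rewrite partial_sum// fct_sumE addrC mulr_suml -big_split/= !mulr_sumr.
congr (_ + _); apply: eq_bigr => j _; first by rewrite partialM.
by rewrite /B !fctE; ring.
Qed.

Lemma div_mul_tensor_div f u y : smooth_on A f -> smooth_on A u -> A y ->
  \sum_i partial i (f * V i * u) y =
  u y * (\sum_i partial i (f * V i) y) + f y * \sum_j V j y * partial j u y.
Proof.
move=> sf su Ay; rewrite !mulr_sumr -big_split/=; apply: eq_bigr => i _.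
have sfV := smooth_onM _ _ _ openA sf (smooth_on_tensor_div i).
rewrite partialM; [|exact: smooth_on_differentiable Ay..].
by rewrite addrC mulrA.
Qed.

(** The term f * V i * (G1 - G2) moves the derivative off G1 - G2, which has no
    C^1 bound proportional to eps, onto the fixed function f. *)
Definition comparison_flux f F1 G1 F2 G2 i : 'rV[R]_m -> R :=
  flux F1 G1 i - flux F2 G2 i - f * V i * (G1 - G2).

Section Comparison.
Variables f F1 G1 F2 G2 : 'rV[R]_m -> R.
Hypotheses (sf : smooth_on A f) (sF1 : smooth_on A F1) (sG1 : smooth_on A G1)
  (sF2 : smooth_on A F2) (sG2 : smooth_on A G2).

Lemma smooth_on_comparison_flux i :
  smooth_on A (comparison_flux f F1 G1 F2 G2 i).
Proof.
apply: smooth_onB => //; first by apply: smooth_onB => //; exact: smooth_on_flux.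
apply: smooth_onM => //; last exact: smooth_onB.
by apply: smooth_onM => //; exact: smooth_on_tensor_div.
Qed.

Lemma comparison_flux_face i y : cube a r y -> face a r i y ->
  comparison_flux f F1 G1 F2 G2 i y = 0.
Proof.
move=> Qy yi; have flux0 F G : flux F G i y = 0.
  rewrite /flux !fctE fct_sumE big1 ?mulr0// => j _.
  by rewrite !fctE (cutoff_face _ _ _ _ yi) mul0r.
rewrite /comparison_flux !fctE !flux0 (tensor_div_face _ _ _ Qy yi).
by rewrite mulr0 mul0r !subr0.
Qed.

(** Besides the difference of the brackets, only terms proportional to F1 - f,
    F2 - f and G1 - G2 are left: this is what makes the estimate linear in the
    C^0 distance. *)
Lemma div_comparison_flux y : A y ->
  \sum_i partial i (comparison_flux f F1 G1 F2 G2 i) y =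
  cube_bump a r y ^+ 2 *
    (\sum_i \sum_j S i j y * (partial i F1 y * partial j G1 y)
     - \sum_i \sum_j S i j y * (partial i F2 y * partial j G2 y))
  + (F1 y - f y) * (\sum_j V j y * partial j G1 y)
  - (F2 y - f y) * (\sum_j V j y * partial j G2 y)
  - (G1 y - G2 y) * (\sum_i partial i (f * V i) y).
Proof.
move=> Ay.
have su : smooth_on A (G1 - G2) by exact: smooth_onB.
have dflux F G (sF : smooth_on A F) (sG : smooth_on A G) i :=
  smooth_on_differentiable y (smooth_on_flux F G i sF sG) Ay.
have dfVu i : differentiable (f * V i * (G1 - G2)) y.
  apply: (smooth_on_differentiable y _ Ay); apply: smooth_onM => //.
  by apply: smooth_onM => //; exact: smooth_on_tensor_div.
have e1 := div_flux F1 G1 y sF1 sG1 Ay.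
have e2 := div_flux F2 G2 y sF2 sG2 Ay.
have e3 := div_mul_tensor_div f (G1 - G2) y sf su Ay.
have Vu : \sum_j V j y * partial j (G1 - G2) y =
    \sum_j V j y * partial j G1 y - \sum_j V j y * partial j G2 y.
  rewrite -sumrB; apply: eq_bigr => j _; rewrite -mulrBr; congr (_ * _).
  by apply: partialB; exact: smooth_on_differentiable Ay.
transitivity (\sum_i partial i (flux F1 G1 i) y
    - \sum_i partial i (flux F2 G2 i) y
    - \sum_i partial i (f * V i * (G1 - G2)) y).
  rewrite -!sumrB; apply: eq_bigr => i _.
  have d12 := differentiableB (dflux F1 G1 sF1 sG1 i) (dflux F2 G2 sF2 sG2 i).
  apply: etrans (partialB i _ _ y d12 (dfVu i)) _; congr (_ - _).
  exact: (partialB i _ _ y (dflux F1 G1 sF1 sG1 i) (dflux F2 G2 sF2 sG2 i)).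
rewrite [X in X - _ - _]e1 [X in _ - X - _]e2 [X in _ - X = _]e3 Vu !fctE.
by ring.
Qed.

End Comparison.

(** Integrate [div_comparison_flux]. The constant depends on f only through the
    supremum b2 of div (f V); b1 bounds V, and c bounds from below the mean of
    the squared bump. *)
Lemma bracket_estimate f : smooth_on A f ->
  exists2 C : R, 0 < C & forall (eps L kap : R) (F1 G1 F2 G2 : 'rV[R]_m -> R),
    0 <= eps -> 1 <= L -> 0 <= kap ->
    smooth_on A F1 -> smooth_on A G1 -> smooth_on A F2 -> smooth_on A G2 ->
    (forall y, cube a r y -> [/\ `|F1 y - f y| <= eps, `|F2 y - f y| <= eps &
      `|G1 y - G2 y| <= 2 * eps]) ->
    (forall y j, cube a r y ->
      `|partial j G1 y| <= L /\ `|partial j G2 y| <= L) ->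
    (forall y, cube a r y ->
      kap <= \sum_i \sum_j S i j y * (partial i F1 y * partial j G1 y)
           - \sum_i \sum_j S i j y * (partial i F2 y * partial j G2 y)) ->
    kap <= C * eps * L.
Proof.
move=> sf.
have bnd j : exists b : R, forall y, cube a r y -> `|V j y| <= b.
  have [|b _ hb] := @continuous_bounded_on_cube _ _ a r r0 A (V j) cubeA.
    by move=> y; exact/smooth_on_continuous/smooth_on_tensor_div.
  by exists b.
have [b bE] := choice bnd.
have sdf : smooth_on A (\sum_i partial i (f * V i)).
  apply: smooth_on_sum => // i _; apply: smooth_on_partial.
  by apply: smooth_onM => //; exact: smooth_on_tensor_div.
have [b2 b20 b2E] := @continuous_bounded_on_cube _ _ a r r0 A _ cubeA
  (fun y => smooth_on_continuous y sdf).
have acube : cube a r a by move=> i; rewrite lexx lerDl ltW.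
pose b1 := \sum_j b j.
have b10 : 0 <= b1.
  by apply: sumr_ge0 => j _; exact: le_trans (bE j a acube).
pose c := (r ^+ 4 / 32) ^+ m.
have c0 : 0 < c by rewrite exprn_gt0// divr_gt0// exprn_gt0.
(* The summand 1 only serves to make the constant positive. *)
exists (2 * (b1 + b2) / c + 1).
  by rewrite ltr_wpDl// divr_ge0 ?(ltW c0)// mulr_ge0// addr_ge0.
move=> eps L kap F1 G1 F2 G2 eps0 L1 kap0 sF1 sG1 sF2 sG2 close dG kapE.
have L0 : 0 <= L by exact: le_trans L1.
have Vsum G y : cube a r y -> (forall j, `|partial j G y| <= L) ->
    `|\sum_j V j y * partial j G y| <= b1 * L.
  move=> Qy dGL; rewrite (le_trans (ler_norm_sum _ _ _))// mulr_suml.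
  by apply: ler_sum => j _; rewrite normrM ler_pM// bE.
have : kap * c <= 2 * (b1 + b2) * eps * L.
  apply: (divergence_bound a r r0 A (comparison_flux f F1 G1 F2 G2) kap _ cubeA
    (smooth_on_comparison_flux f F1 G1 F2 G2 sf sF1 sG1 sF2 sG2)
    (comparison_flux_face f F1 G1 F2 G2) kap0) => y Qy.
  have [f1 f2 g12] := close y Qy.
  rewrite [X in _ <= X + _]
    (div_comparison_flux f F1 G1 F2 G2 sf sF1 sG1 sF2 sG2 y (cubeA _ Qy)).
  have V1 : `|(F1 y - f y) * \sum_j V j y * partial j G1 y| <= eps * (b1 * L).
    by rewrite normrM ler_pM// Vsum// => j; have [] := dG y j Qy.
  have V2 : `|(F2 y - f y) * \sum_j V j y * partial j G2 y| <= eps * (b1 * L).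
    by rewrite normrM ler_pM// Vsum// => j; have [] := dG y j Qy.
  have V3 : `|(G1 y - G2 y) * (\sum_i partial i (f * V i) y)| <= 2 * eps * (b2 * L).
    rewrite normrM ler_pM//.
    rewrite (@le_trans _ _ b2)//; first by have := b2E y Qy; rewrite fct_sumE.
    by rewrite ler_peMr.
  have := ler_wpM2l (sqr_ge0 (cube_bump a r y)) (kapE y Qy).
  move: V1 V2 V3 => /ler_normlP[+ +] /ler_normlP[+ +] /ler_normlP[+ +].
  move: (_ * \sum_j _) (_ * \sum_j _) (_ * \sum_i _) => X1 X2 X3.
  move: (_ ^+ 2) (_ - \sum_i \sum_j _) => w d.
  rewrite (mulrC w kap); move: (kap * w) (w * d) => kw wd.
  by move=> *; lra.
rewrite -ler_pdivlMr// => /le_trans; apply.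
rewrite -subr_ge0 (_ : _ - _ = eps * L) ?mulr_ge0//.
by field; rewrite gt_eqF.
Qed.

End CutoffTensor.
End BracketEstimate.

(** * Changes of coordinates *)

Section ChartCalculus.
Context {R : realType} {m : nat} {M : smooth_manifold R m}.
Implicit Types (c : chart R m M) (F : M -> R) (y : 'rV[R]_m).

Lemma open_chart_preimage c (D : set M) : open D ->
  open (chart_cod c `&` chart_inv c @^-1` D).
Proof.
move=> oD; have oc := @chart_cod_open _ _ _ c.
have := @chart_inv_continuous _ _ _ c; rewrite continuous_open_subspace// => cont.
rewrite openE => y [yc yD]; apply: filterI; first exact: open_nbhs_nbhs.
by apply: cont; [rewrite inE|exact: open_nbhs_nbhs].
Qed.

Definition transition c c' : 'rV[R]_m -> 'rV[R]_m := chart_map c' \o chart_inv c.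

Definition overlap c c' : set 'rV[R]_m :=
  chart_cod c `&` chart_inv c @^-1` chart_dom c'.

Lemma near_overlap c c' y : overlap c c' y -> \near y, overlap c c' y.
Proof.
move=> yc; apply: open_nbhs_nbhs; split => //.
exact: open_chart_preimage (@chart_dom_open _ _ _ c').
Qed.

Lemma chart_inv_transition c c' y : overlap c c' y ->
  chart_inv c' (transition c c' y) = chart_inv c y.
Proof. by move=> [_ yc']; apply: chart_mapK; rewrite inE. Qed.

Lemma overlap_transition c c' y : overlap c c' y ->
  overlap c' c (transition c c' y).
Proof.
move=> yo; have [yc yc'] := yo; split; first exact: (chart_map_fun yc').
by rewrite /= (chart_inv_transition _ _ _ yo); exact: (chart_inv_fun yc).
Qed.

Lemma transitionK c c' y : overlap c c' y ->
  transition c' c (transition c c' y) = y.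
Proof.
move=> yo; rewrite {1}/transition /= chart_inv_transition//.
by apply: chart_invK; rewrite inE; case: yo.
Qed.

Lemma differentiable_row (f : 'rV[R]_m -> 'rV[R]_m) y :
  (forall k, differentiable (fun z => f z 0 k) y) -> differentiable f y.
Proof.
move=> df; have -> : f = \sum_(k < m) (fun z => f z 0 k *: 'e_k).
  by apply/funext => z; rewrite fct_sumE -row_sum_delta.
by apply: differentiable_sum => k; exact: differentiableZl.
Qed.

Lemma differentiable_transition c c' y : atlas c -> atlas c' ->
  overlap c c' y -> differentiable (transition c c') y.
Proof.
move=> ac ac' yo; apply: differentiable_row => k.
exact: (atlas_compatible ac ac' k [::] yo).
Qed.

(** Transition maps have mutually inverse differentials, which makes the
    coordinate fields of any chart of the atlas a basis of each tangent space
    ([coord_vec_span], [coord_vec_free]). *)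
Lemma diff_transitionK c c' y (v : 'rV[R]_m) : atlas c -> atlas c' ->
  overlap c c' y ->
  'd (transition c' c) (transition c c' y) ('d (transition c c') y v) = v.
Proof.
move=> ac ac' yo.
have d1 := differentiable_transition _ _ _ ac ac' yo.
have d2 := differentiable_transition _ _ _ ac' ac (overlap_transition _ _ _ yo).
have near_id : \near y, id y = (transition c' c \o transition c c') y.
  by apply: filterS (near_overlap _ _ _ yo) => z /transitionK.
have did : differentiable (@id 'rV[R]_m) y by exact/ex_diff.
have dd := near_eq_is_diff _ _ _ _ _ near_id did.
have := congr1 (@^~ v) (@diff_val _ _ _ _ _ _ _ dd).
have id_id : is_diff y (@id 'rV[R]_m) id by exact: is_diff_id.
move=> ddv; apply: etrans (etrans (esym _) ddv) _.
  exact: (congr1 (@^~ v) (diff_comp d1 d2)).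
exact: (congr1 (@^~ v) (@diff_val _ _ _ _ _ _ _ id_id)).
Qed.

(** The chain rule for F read in two charts; it relates [mdiff], which uses the
    preferred chart of each point, to partial derivatives in a fixed chart. *)
Lemma diff_chart_comp F c c' y (v : 'rV[R]_m) :
  atlas c -> atlas c' -> smooth F ->
  overlap c c' y ->
  'd (F \o chart_inv c) y v =
  'd (F \o chart_inv c') (transition c c' y) ('d (transition c c') y v).
Proof.
move=> ac ac' sF yo.
have d1 := differentiable_transition _ _ _ ac ac' yo.
have d2 : differentiable (F \o chart_inv c') (transition c c' y).
  by apply: (sF c' ac' [::]); have [] := overlap_transition _ _ _ yo.
have near_eq : \near y,
    ((F \o chart_inv c') \o transition c c') y = (F \o chart_inv c) y.
  apply: filterS (near_overlap _ _ _ yo) => z zo.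
  by rewrite /= chart_inv_transition.
have dd := near_eq_is_diff _ _ _ _ _ near_eq (differentiable_comp d1 d2).
apply: etrans (congr1 (@^~ v) (@diff_val _ _ _ _ _ _ _ dd)) _.
exact: (congr1 (@^~ v) (diff_comp d1 d2)).
Qed.

Section PointOfChart.
Variables (c : chart R m M) (y : 'rV[R]_m).
Hypotheses (ac : atlas c) (yc : chart_cod c y).
Let x := chart_inv c y.

Lemma overlap_chart_at : overlap c (chart_at x) y.
Proof. by split => //=; exact: mem_chart_at. Qed.

Lemma coord_vecE i : coord_vec c i x = 'd (transition c (chart_at x)) y (basis_vec i).
Proof. by rewrite /coord_vec {2}/x chart_invK ?inE. Qed.

Lemma mdiff_coord_vec F i : smooth F ->
  mdiff F (coord_vec c i x) = partial i (F \o chart_inv c) y.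
Proof.
move=> sF; rewrite coord_vecE /partial deriveE; last exact: (sF c ac [::]).
rewrite (diff_chart_comp F c (chart_at x))//; first exact: chart_at_atlas.
exact: overlap_chart_at.
Qed.

Lemma coord_vec_comb (a : 'rV[R]_m) :
  \sum_i a 0 i *: coord_vec c i x = 'd (transition c (chart_at x)) y a.
Proof.
rewrite [in RHS](row_sum_delta a) linear_sum/=; apply: eq_bigr => i _.
by rewrite linearZ coord_vecE.
Qed.

Lemma coord_vec_span (v : tangent x) :
  exists a : 'rV[R]_m, v = \sum_i a 0 i *: coord_vec c i x.
Proof.
have yo := overlap_chart_at; pose c' := chart_at x.
exists ('d (transition c' c) (transition c c' y) v); rewrite coord_vec_comb.
have := diff_transitionK c' c (transition c c' y) v (chart_at_atlas x) ac
  (overlap_transition _ _ _ yo).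
by rewrite transitionK// => ->.
Qed.

Lemma coord_vec_free (a : 'rV[R]_m) :
  \sum_i a 0 i *: coord_vec c i x = 0 -> a = 0.
Proof.
rewrite coord_vec_comb => a0.
have aE := diff_transitionK c (chart_at x) y a ac (chart_at_atlas x) overlap_chart_at.
exact: etrans (esym aE) (etrans (congr1 _ a0) (linear0 _)).
Qed.

End PointOfChart.
End ChartCalculus.

(** * The Poisson bracket and the metric in a chart *)

Section SmoothMatrices.
Context {R : realType} {m : nat}.
Implicit Types (A : set 'rV[R]_m).

Lemma smooth_on_det A n (W : 'I_n -> 'I_n -> 'rV[R]_m -> R) : open A ->
  (forall i j, smooth_on A (W i j)) ->
  smooth_on A (fun y => \det (\matrix_(i, j) W i j y)).
Proof.
move=> oA sW.
have -> : (fun y => \det (\matrix_(i, j) W i j y)) =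
    \sum_(s : {perm 'I_n}) (cst ((-1) ^+ s) * \prod_i W i (s i)).
  apply/funext => y; rewrite fct_sumE; apply: eq_bigr => s _.
  rewrite !fctE fct_prodE; congr (_ * _).
  by apply: eq_bigr => i _; rewrite mxE.
apply: smooth_on_sum => // s _; apply: smooth_onM => //.
  exact: smooth_on_cst.
exact: smooth_on_prod.
Qed.

Lemma smooth_on_adjugate A n (W : 'I_n -> 'I_n -> 'rV[R]_m -> R) i j : open A ->
  (forall i j, smooth_on A (W i j)) ->
  smooth_on A (fun y => \adj (\matrix_(i, j) W i j y) i j).
Proof.
move=> oA sW; pose W' k l := W (lift j k) (lift i l).
have -> : (fun y => \adj (\matrix_(i, j) W i j y) i j) =
    cst ((-1) ^+ (j + i)) * (fun y => \det (\matrix_(k, l) W' k l y)).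
  apply/funext => y; rewrite !fctE mxE /cofactor; congr (_ * \det _).
  by apply/matrixP => k l; rewrite !mxE.
apply: smooth_onM => //; first exact: smooth_on_cst.
by apply: smooth_on_det => // k l; exact: sW.
Qed.

Lemma invmx_skew n (W : 'M[R]_n) i j : W \in unitmx -> W^T = - W ->
  invmx W i j = - invmx W j i.
Proof.
move=> uW WT; have : (invmx W)^T *m W^T = 1%:M.
  by rewrite -trmx_mul mulmxV// trmx1.
rewrite WT mulmxN => /(congr1 (mulmx^~ (invmx W))).
rewrite mulNmx -mulmxA mulmxV// mulmx1 mul1mx => /matrixP/(_ i j).
by rewrite !mxE => <-.
Qed.

End SmoothMatrices.

Section PoissonInChart.
Context {R : realType} {m : nat} {M : smooth_manifold R m}.
Variables (omega : symplectic_form M) (c : chart R m M) (ac : atlas c).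
Implicit Types (y : 'rV[R]_m) (F G : M -> R).

Definition sform_mx y : 'M[R]_m :=
  \matrix_(i, j) tensor_coef (fun x => omega x) c i j y.

(** (det W)^2 W^-1, transposed, in the polynomial form det W * adj W. *)
Definition bivector i j y : R := \det (sform_mx y) * \adj (sform_mx y) j i.

Lemma smooth_on_det_sform : smooth_on (chart_cod c) (fun y => \det (sform_mx y)).
Proof.
apply: smooth_on_det; first exact: chart_cod_open.
by move=> i j; exact: sform_smooth.
Qed.

Lemma smooth_on_bivector i j : smooth_on (chart_cod c) (bivector i j).
Proof.
apply: smooth_onM; [exact: chart_cod_open|exact: smooth_on_det_sform|].
apply: smooth_on_adjugate; first exact: chart_cod_open.
by move=> k l; exact: sform_smooth.
Qed.

Lemma mdiffZ F x (k : R) (v : tangent x) : mdiff F (k *: v) = k * mdiff F v.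
Proof. exact: linearZ. Qed.

Lemma mdiff_sum F x n (a : 'I_n -> R) (v : 'I_n -> tangent x) :
  mdiff F (\sum_i a i *: v i) = \sum_i a i * mdiff F (v i).
Proof. by rewrite /mdiff linear_sum; apply: eq_bigr => i _; rewrite linearZ. Qed.

Lemma sform_suml x n (a : 'I_n -> R) (v : 'I_n -> tangent x) (w : tangent x) :
  omega x (\sum_i a i *: v i) w = \sum_i a i * omega x (v i) w.
Proof.
by rewrite linear_sumlz; apply: eq_bigr => i _; rewrite linearZl_LR.
Qed.

Lemma sform_sumr x n (a : 'I_n -> R) (v : 'I_n -> tangent x) (w : tangent x) :
  omega x w (\sum_i a i *: v i) = \sum_i a i * omega x w (v i).
Proof.
by rewrite linear_sumr; apply: eq_bigr => i _; rewrite linearZr_LR.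
Qed.

Section AtPoint.
Variables (y : 'rV[R]_m) (yc : chart_cod c y).
Let x := chart_inv c y.
Let W := sform_mx y.

Lemma sform_mxT : W^T = - W.
Proof.
apply/matrixP => i j; rewrite !mxE /tensor_coef.
by rewrite hermC expr1 mulN1r.
Qed.

Lemma sform_mx_row (a : 'rV[R]_m) j :
  omega x (\sum_i a 0 i *: coord_vec c i x) (coord_vec c j x) = (a *m W) 0 j.
Proof.
by rewrite sform_suml mxE; apply: eq_bigr => i _; rewrite !mxE.
Qed.

Lemma eq_on_coord_vec (v : tangent x) (h : tangent x -> R) :
  (forall n (a : 'I_n -> R) (u : 'I_n -> tangent x),
    h (\sum_i a i *: u i) = \sum_i a i * h (u i)) ->
  (forall j, omega x v (coord_vec c j x) = h (coord_vec c j x)) ->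
  forall w, omega x v w = h w.
Proof.
move=> hlin vh w; have [b ->] := coord_vec_span c y ac yc w.
by rewrite sform_sumr hlin; apply: eq_bigr => j _; rewrite vh.
Qed.

(** A row vector killed by the matrix gives a tangent vector orthogonal to all
    coordinate vectors, hence to everything. *)
Lemma sform_mx_unit : W \in unitmx.
Proof.
rewrite -row_free_unit; apply: inj_row_free => a aW.
apply: (coord_vec_free c y ac yc); apply: (@sform_nondegenerate _ _ _ omega).
apply: (eq_on_coord_vec _ (fun=> 0)) => [n b u|j].
  by rewrite big1// => i _; rewrite mulr0.
by rewrite sform_mx_row aW mxE.
Qed.

Lemma det_sform_neq0 : \det W != 0.
Proof. by rewrite -unitfE -unitmxE sform_mx_unit. Qed.

Lemma bivectorE i j : bivector i j y = \det W ^+ 2 * invmx W j i.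
Proof.
rewrite /bivector -/W expr2 -mulrA; congr (_ * _).
by rewrite /invmx sform_mx_unit [in RHS]mxE mulVKf// det_sform_neq0.
Qed.

Lemma bivector_skew i j : bivector i j y = - bivector j i y.
Proof.
by rewrite !bivectorE (invmx_skew _ _ _ _ sform_mx_unit sform_mxT) mulrN.
Qed.

(** The vector with coordinates dG * W^-1 satisfies the equation defining the
    Hamiltonian field of G, and by nondegeneracy it is the only one. *)
Lemma poisson_chart F G : smooth F -> smooth G ->
  \det W ^+ 2 * poisson omega F G x =
  \sum_i \sum_j bivector i j y *
    (partial i (F \o chart_inv c) y * partial j (G \o chart_inv c) y).
Proof.
move=> sF sG.
pose a : 'rV[R]_m := (\row_j partial j (G \o chart_inv c) y) *m invmx W.
pose v : tangent x := \sum_i a 0 i *: coord_vec c i x.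
have vG : forall w, omega x v w = mdiff G w.
  apply: eq_on_coord_vec => [|j]; first exact: mdiff_sum.
  rewrite sform_mx_row mulmxKV ?sform_mx_unit// mxE.
  by rewrite (mdiff_coord_vec c y ac yc).
have -> : poisson omega F G x = mdiff F v.
  rewrite /poisson /hamiltonian_field; congr mdiff.
  case: xgetP => [u _ uG|/(_ v)]; last by move=> /(_ vG).
  apply/eqP; rewrite -subr_eq0; apply/eqP.
  have {}uG : forall w, omega x u w = mdiff G w := uG.
  apply: (@sform_nondegenerate _ _ _ omega) => w; rewrite linearBl; apply/eqP.
  by rewrite subr_eq0; apply/eqP; exact: etrans (uG w) (esym (vG w)).
rewrite mdiff_sum mulr_sumr; apply: eq_bigr => i _.
rewrite (mdiff_coord_vec c y ac yc)// mxE mulr_suml mulr_sumr.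
by apply: eq_bigr => j _; rewrite bivectorE mxE; ring.
Qed.

(** Normalize the coordinate vector to a unit vector for the metric. *)
Lemma partial_le_norm1 (U : set M) (rho : riemannian_metric U) G i (L : R) :
  smooth G -> (norm1_at rho G x <= L%:E)%E ->
  `|partial i (G \o chart_inv c) y| <=
  Num.sqrt (tensor_coef (fun x => rho x) c i i y) * L.
Proof.
move=> sG GL; rewrite -(mdiff_coord_vec c y ac yc)// /tensor_coef -/x.
set v := coord_vec c i x.
have [v0|v0] := eqVneq v 0.
  by rewrite v0 /mdiff linear0 normr0 linear0l sqrtr0 mul0r.
set s := Num.sqrt _.
have rv : 0 < rho x v v by exact: neq0_dnorm_gt0.
have s0 : 0 < s by rewrite sqrtr_gt0.
have : `|mdiff G (s^-1 *: v)| <= L.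
  rewrite -lee_fin; apply: le_trans GL; apply: ereal_sup_ubound.
  exists (s^-1 *: v) => //=.
  rewrite linearZl_LR/= linearZr_LR/= -[rho x v v](@sqr_sqrtr R) ?ltW// -/s.
  by rewrite (_ : _ * _ = 1) ?sqrtr1//; field; rewrite gt_eqF.
rewrite mdiffZ normrM gtr0_norm ?invr_gt0//.
by rewrite mulrC ler_pdivrMr// mulrC.
Qed.

End AtPoint.
End PoissonInChart.

(** * The theorem *)

Theorem theorem1p2p4 (R : realType) (m : nat) (M : smooth_manifold R m)
    (omega : symplectic_form M) (U : set M)
    (U_open : open U) (U_nonempty : U !=set0) (U_cpt : compact (closure U))
    (rho : riemannian_metric U) (f g : M -> R)
    (f_smooth : smooth f) (g_smooth : smooth g) :
  exists2 C : R, 0 < C &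
    forall (eps : R) (F1 G1 F2 G2 : M -> R), 0 < eps ->
      smooth F1 -> smooth G1 -> smooth F2 -> smooth G2 ->
      (sup_norm U (F1 \- f)%R < eps%:E)%E ->
      (sup_norm U (F2 \- f)%R < eps%:E)%E ->
      (sup_norm U (G1 \- g)%R < eps%:E)%E ->
      (sup_norm U (G2 \- g)%R < eps%:E)%E ->
      (ereal_inf [set `|poisson omega F1 G1 y - poisson omega F2 G2 z|%:E
                 | y in U & z in U]
       <= (C * eps)%:E
          * maxe 1 (maxe (sup_norm1 rho G1) (sup_norm1 rho G2)))%E.
Proof.
case: U_nonempty => x0 Ux0.
pose c := chart_at x0; have ac : atlas c := chart_at_atlas x0.
pose A := chart_cod c `&` chart_inv c @^-1` U.
have oA : open A by exact: open_chart_preimage.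
pose y0 := chart_map c x0.
have Ay0 : A y0.
  split; first exact: (chart_map_fun (mem_chart_at x0)).
  by rewrite /= /y0 chart_mapK// inE; exact: mem_chart_at.
have sA h : smooth h -> smooth_on A (h \o chart_inv c).
  by move=> sh; apply: smooth_onS (sh c ac) => y [].
pose dt y := \det (sform_mx omega c y) ^+ 2.
have sdt : smooth_on A dt.
  have sd : smooth_on A (fun y => \det (sform_mx omega c y)).
    by apply: smooth_onS (smooth_on_det_sform omega c ac) => y [].
  exact: (smooth_onM _ _ _ oA sd sd).
have dt0 : 0 < dt y0.
  by rewrite exprn_even_gt0//= det_sform_neq0//; case: Ay0.
pose del := dt y0 / 2.
have del0 : 0 < del by rewrite divr_gt0.
(* On a small cube with corner y0 the chart stays inside U and (det W)^2 above
   del. *)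
have [e /= e0 ye] : nbhs_ball y0 (A `&` [set y | del < dt y]).
  apply/nbhs_ballP/filterI; first exact: open_nbhs_nbhs.
  have /cvgr_gt := smooth_on_continuous y0 sdt Ay0; apply.
  by rewrite /del ltr_pdivrMr// ltr_pMr// ltr1n.
pose r := e / 2; have r0 : 0 < r by rewrite divr_gt0.
have Qe y : cube y0 r y -> A y /\ del < dt y.
  move=> Qy; apply: ye; split=> // i j; rewrite !ord1.
  rewrite /ball /= ltr_distlC; have := Qy j; rewrite /r => /andP[? ?].
  by apply/andP; split; lra.
have QA : cube y0 r `<=` A by move=> y /Qe[].
have sbiv i j : smooth_on A (bivector omega c i j).
  by apply: smooth_onS (smooth_on_bivector omega c ac i j) => y [].
have skew i j y : A y -> bivector omega c i j y = - bivector omega c j i y.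
  by case=> yc _; exact: bivector_skew.
have [C0 C00 estimate] := bracket_estimate A y0 r oA r0 QA
  (bivector omega c) sbiv skew _ (sA f f_smooth).
have bnd i : exists b : R, 0 <= b /\ forall y, cube y0 r y ->
    Num.sqrt (tensor_coef (fun x => rho x) c i i y) <= b.
  have [|b b0 hb] := @continuous_bounded_on_cube _ _ y0 r r0 A
      (fun y => Num.sqrt (tensor_coef (fun x => rho x) c i i y)) QA.
    move=> y Ay; apply: (@continuous_comp _ _ _ _ Num.sqrt).
      exact: (smooth_on_continuous y (metric_smooth rho ac i i) Ay).
    exact: sqrt_continuous.
  by exists b; split => // y /hb; apply: le_trans; exact: ler_norm.
have [b bE] := choice bnd.
(* D bounds the lengths of all coordinate fields; the summand 1 makes D * L >= 1
   below. *)
pose D := 1 + \sum_i b i.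
have bD i y : cube y0 r y ->
    Num.sqrt (tensor_coef (fun x => rho x) c i i y) <= D.
  move=> Qy; rewrite (le_trans ((bE i).2 y Qy))// /D (bigD1 i)//= addrCA lerDl.
  by rewrite addr_ge0// sumr_ge0// => j _; exact: (bE j).1.
have D1 : 1 <= D by rewrite /D lerDl sumr_ge0// => j _; exact: (bE j).1.
exists (C0 * D / del); first by rewrite divr_gt0// mulr_gt0//; lra.
move=> eps F1 G1 F2 G2 eps0 sF1 sG1 sF2 sG2 F1f F2f G1g G2g.
set K := ereal_inf _; set mx := (maxe 1 _)%E.
have mx1 : (1 <= mx)%E by rewrite le_max lexx.
have mxG1 : (sup_norm1 rho G1 <= mx)%E.
  by rewrite le_max; apply/orP; right; rewrite le_max; apply/orP; left.
have mxG2 : (sup_norm1 rho G2 <= mx)%E.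
  by rewrite le_max; apply/orP; right; rewrite le_max; apply/orP; right.
have Ceps0 : 0 < C0 * D / del * eps.
  by rewrite mulr_gt0// divr_gt0// mulr_gt0//; lra.
case: mx mx1 mxG1 mxG2 => [L| |]; last 2 first.
- by move=> *; rewrite gt0_muley ?lte_fin// leey.
- by [].
rewrite lee_fin => L1 G1L G2L.
have close h h' x : U x -> (sup_norm U (h \- h')%R < eps%:E)%E ->
    `|h x - h' x| <= eps.
  move=> Ux hh'; rewrite -lee_fin; apply: le_trans (ltW hh').
  by apply: ereal_sup_ubound; exists x.
have grad G y j : smooth G -> (sup_norm1 rho G <= L%:E)%E -> cube y0 r y ->
    `|partial j (G \o chart_inv c) y| <= D * L.
  move=> sG GL Qy; have [yc Uy] := QA _ Qy.
  apply: le_trans (partial_le_norm1 c ac y yc U rho G j L sG _) _.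
    by apply: le_trans GL; apply: ereal_sup_ubound; exists (chart_inv c y).
  by rewrite ler_wpM2r ?bD//; lra.
have DL1 : 1 <= D * L by rewrite mulr_ege1.
have K0 : (0 <= K)%E.
  by apply: le_ereal_inf_tmp => _ [y Uy [z Uz <-]]; rewrite lee_fin.
have KE y z : U y -> U z ->
    (K <= `|poisson omega F1 G1 y - poisson omega F2 G2 z|%:E)%E.
  by move=> Uy Uz; apply: ereal_inf_lbound; exists y => //; exists z.
have Kfin : K \is a fin_num.
  rewrite ge0_fin_numE//; apply: le_lt_trans (KE x0 x0 Ux0 Ux0) _.
  exact: ltry.
pose k := fine K.
have k0 : 0 <= k by exact: fine_ge0.
rewrite -(fineK Kfin) -EFinM lee_fin -/k.
pose tF1 := F1 \o chart_inv c; pose tF2 := F2 \o chart_inv c.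
pose tG1 := G1 \o chart_inv c; pose tG2 := G2 \o chart_inv c.
(* The bracket of F and G read in the chart, multiplied by (det W)^2. *)
pose br (F G : 'rV[R]_m -> R) y := \sum_i \sum_j
  bivector omega c i j y * (partial i F y * partial j G y).
have sbr F G : smooth_on A F -> smooth_on A G -> smooth_on A (br F G).
  move=> sF sG; have -> : br F G = \sum_i \sum_j
      (bivector omega c i j * (partial i F * partial j G)).
    apply/funext => y; rewrite fct_sumE; apply: eq_bigr => i _.
    by rewrite fct_sumE.
  apply: smooth_on_sum => // i _; apply: smooth_on_sum => // j _.
  apply: smooth_onM => //.
  by apply: smooth_onM => //; exact: smooth_on_partial.
have brE F G y : smooth F -> smooth G -> A y ->
    br (F \o chart_inv c) (G \o chart_inv c) y =
    dt y * poisson omega F G (chart_inv c y).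
  by move=> sF sG [yc _]; rewrite /br -poisson_chart.
pose h y := br tF1 tG1 y - br tF2 tG2 y.
have hk y : cube y0 r y -> del * k <= `|h y|.
  move=> Qy; have [Ay ddt] := Qe y Qy; have Uy := Ay.2.
  rewrite /h !brE// -mulrBr normrM ler_pM// ?(ltW del0)//.
    by rewrite (le_trans (ltW ddt))// ler_norm.
  by rewrite -lee_fin fineK//; exact: KE.
have [k_eq0|k_neq0] := eqVneq k 0.
  by rewrite k_eq0 mulr_ge0// ?(ltW Ceps0)//; lra.
have k_gt0 : 0 < k by rewrite lt0r k_neq0.
have sh : smooth_on A h by apply: smooth_onB => //; apply: sbr; exact: sA.
suff : del * k <= C0 * eps * (D * L).
  rewrite -ler_pdivlMl// => /le_trans; apply.
  rewrite le_eqVlt; apply/orP; left; apply/eqP; field.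
  by rewrite gt_eqF.
have closeQ F y : cube y0 r y -> (sup_norm U (F \- f)%R < eps%:E)%E ->
    `|(F \o chart_inv c) y - (f \o chart_inv c) y| <= eps.
  by move=> Qy; apply: close; exact: (QA _ Qy).2.
have closeG y : cube y0 r y -> `|tG1 y - tG2 y| <= 2 * eps.
  move=> Qy; have Uy := (QA _ Qy).2.
  rewrite (le_trans (ler_distD (g (chart_inv c y)) _ _))// mulr2n mulrDl mul1r.
  by rewrite lerD// ?[`|g _ - _|]distrC; exact: close.
(* The estimate is applied to (F1, G1), (F2, G2) in the order for which the
   difference of the brackets is positive. *)
have [hpos|hneg] := cube_constant_sign y0 r r0 h (del * k) (mulr_gt0 del0 k_gt0)
  (fun y Qy => smooth_on_continuous y sh (QA y Qy)) hk.
- apply: (estimate eps (D * L) (del * k) tF1 tG1 tF2 tG2) => //; try exact: sA.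
  + exact: ltW.
  + by rewrite mulr_ge0// ltW.
  + by move=> y Qy; split; [exact: closeQ|exact: closeQ|exact: closeG].
  + by move=> y j Qy; split; exact: grad.
- apply: (estimate eps (D * L) (del * k) tF2 tG2 tF1 tG1) => //; try exact: sA.
  + exact: ltW.
  + by rewrite mulr_ge0// ltW.
  + move=> y Qy; split; [exact: closeQ|exact: closeQ|].
    by rewrite distrC; exact: closeG.
  + by move=> y j Qy; split; exact: grad.
  + by move=> y Qy; have := hneg y Qy; rewrite /h opprB.
Qed.
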